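(* Let $m=2k+1\ge 1$ be an odd integer (so $k\ge 0$). Then $$\overline{\mathrm{OPT}}_m(2)-\overline{\mathrm{OPT}}_m(1)\equiv -4k\pmod{16},$$ $$\overline{\mathrm{OPT}}_m(4)-\overline{\mathrm{OPT}}_m(2)\equiv 4\pmod{16},$$ and for every integer $n\ge 0$, $$\overline{\mathrm{OPT}}_m(2n)\equiv\overline{\mathrm{OPT}}_m(n)\pmod 4,\qquad \overline{\mathrm{OPT}}_m(4n)\equiv\overline{\mathrm{OPT}}_m(2n)\pmod 4.$$
   Context: An overpartition of $n$ is a partition of $n$ in which the first occurrence of each part may be overlined. For an integer $m\ge 1$, $\overline{\mathrm{OPT}}_m(n)$ denotes the number of overpartition $m$-tuples of $n$ into odd parts, i.e. $m$-tuples of overpartitions all of whose parts are odd and whose parts sum (over all components) to $n$. Equivalently, $$\sum_{n\ge 0}\overline{\mathrm{OPT}}_m(n)q^n=\prod_{j\ge 1,\ j\text{ odd}}\left(\frac{1+q^j}{1-q^j}\right)^m\in\mathbb{Z}[[q]].$$ *)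

(* Defs.v *)
From mathcomp Require Import all_boot all_order all_algebra.

Set Implicit Arguments.
Unset Strict Implicit.
Unset Printing Implicit Defensive.

(* A list of parts, each with a flag telling whether it is overlined. *)
Definition overlist := seq (nat * bool).

Definition weight (s : overlist) : nat := sumn (unzip1 s).

(* In the pairwise condition x stands before y in s, so a part that already
   occurred earlier in the list cannot be overlined. *)
Definition is_overpartition (s : overlist) : bool :=
  [&& sorted geq (unzip1 s),
      all (fun x => 0 < x.1) s
    & pairwise (fun x y => (x.1 == y.1) ==> ~~ y.2) s].

Definition odd_parts (s : overlist) : bool := all (fun x => odd x.1) s.

Definition is_odd_overpartition_tuple (n : nat) (ts : seq overlist) : bool :=
  [&& all is_overpartition ts,
      all odd_parts ts
    & \sum_(s <- ts) weight s == n].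

(* The components of a tuple of total weight n have at most n parts, each of
   them at most n, so such tuples all live in a finite type; lemma OPT_count
   shows that this encoding loses nothing. *)
Definition overcode (n : nat) := n.-bseq ('I_n.+1 * bool).

Definition decode (n : nat) (c : overcode n) : overlist :=
  [seq (x.1 : nat, x.2) | x : 'I_n.+1 * bool <- c].

Definition OPT (m n : nat) : nat :=
  #|[set t : m.-tuple (overcode n)
     | is_odd_overpartition_tuple n [seq decode c | c <- t]]|.

Lemma decode_inj (n : nat) : injective (@decode n).
Proof.
move=> c d /inj_map e; apply: val_inj; apply: e.
by move=> [i a] [j b] [/val_inj -> ->].
Qed.

Lemma decode_surj (n : nat) (s : overlist) :
  is_overpartition s -> weight s <= n -> exists c : overcode n, decode c = s.
Proof.
case/and3P=> _ pos _ le_n.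
have szs : size [seq (inord x.1 : 'I_n.+1, x.2) | x <- s] <= n.
  rewrite size_map; apply: leq_trans le_n; elim: s pos => //= x s IHs.
  by case/andP=> x0 /IHs; rewrite /weight /= -add1n => /(leq_add x0).
exists (Bseq szs); rewrite /decode /= -map_comp map_id_in // => -[a b] /= ab.
rewrite inordK // ltnS; apply: leq_trans le_n.
elim: s ab {pos szs} => //= x s IHs; rewrite inE /weight /=.
case/predU1P=> [<- /=|/IHs]; first exact: leq_addr.
by move/leq_trans; apply; apply: leq_addl.
Qed.

Lemma OPT_count (m n : nat) (e : seq (m.-tuple overlist)) :
  uniq e ->
  (forall t : m.-tuple overlist, (t \in e) = is_odd_overpartition_tuple n t) ->
  OPT m n = size e.
Proof.
move=> ue he; rewrite /OPT; set A := [set t : m.-tuple (overcode n) | _].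
pose f (t : m.-tuple (overcode n)) : m.-tuple overlist := map_tuple (@decode n) t.
have f_inj : injective f.
  move=> t u /(congr1 val) /(inj_map (@decode_inj n)); exact: val_inj.
have /perm_size <- : perm_eq [seq f t | t <- enum A] e.
  apply: uniq_perm => //; first by rewrite map_inj_uniq ?enum_uniq.
  move=> t; rewrite he; apply/mapP/idP => [[u + ->]|ht].
    by rewrite mem_enum inE.
  have dec i : exists c : overcode n, decode c == tnth t i.
    case/and3P: (ht) => /allP ovt _ /eqP sumt.
    have [||c <-] := @decode_surj n (tnth t i); last by exists c.
      exact/ovt/mem_tnth.
    by rewrite -sumt big_tnth (bigD1 (cast_ord (esym (size_tuple t)) i)) //=
      (tnth_nth [::]) /= (tnth_nth [::]) leq_addr.
  have ft : t = f [tuple xchoose (dec i) | i < m].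
    apply: eq_from_tnth => i; rewrite tnth_map tnth_mktuple.
    by have /eqP := xchooseP (dec i).
  by exists [tuple xchoose (dec i) | i < m]; rewrite // mem_enum inE; move: ht; rewrite {1}ft.
by rewrite size_map -cardE.
Qed.

(* Main.v *)
(* Overlining multiplies a partition with d distinct part sizes by 2 ^ d, so
   modulo 4 the number a(n) of overpartitions of n > 0 into odd parts is twice
   the number of odd divisors of n, which is unchanged by n -> 2n.  As a(0) = 1
   and a(n) is even for n > 0, taking the m-th power of the generating function
   modulo 4 keeps only the linear term: OPT m n = m * a(n) for n > 0.  The
   congruences modulo 16 come from closed forms in m of OPT m 1, OPT m 2 and
   OPT m 4, together with m ^ 2 = 1 modulo 8. *)
Require Import Defs.
From mathcomp Require Import all_boot all_order all_algebra.
From mathcomp Require Import zify.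

Set Implicit Arguments.
Unset Strict Implicit.
Unset Printing Implicit Defensive.

(** * Counting by explicit enumeration *)

(** Lists of parts form an infinite type, so a cardinality is witnessed by a duplicate-free
    enumeration, which is the form [OPT_count] consumes. *)
Definition counted (T : eqType) (P : pred T) (k : nat) : Prop :=
  exists e : seq T, [/\ uniq e, forall x, (x \in e) = P x & size e = k].

Lemma eq_counted (T : eqType) (P Q : pred T) k :
  P =1 Q -> counted P k -> counted Q k.
Proof.
by move=> ePQ [e [ue he <-]]; exists e; split=> // x; rewrite he; apply: ePQ.
Qed.

Lemma counted0 (T : eqType) (P : pred T) : P =1 xpred0 -> counted P 0.
Proof. by move=> P0; exists [::]; split=> // x; rewrite P0. Qed.

Lemma counted1 (T : eqType) (P : pred T) x : P =1 pred1 x -> counted P 1.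
Proof.
by move=> P1; exists [:: x]; split=> // y; rewrite inE P1.
Qed.

Lemma counted_split (T : eqType) (q P : pred T) k l :
    counted (fun x => P x && q x) k -> counted (fun x => P x && ~~ q x) l ->
  counted P (k + l).
Proof.
move=> [e [ue he <-]] [f [uf hf <-]]; exists (e ++ f); split=> [|x|].
- rewrite cat_uniq ue uf andbT; apply/hasPn => x.
  by rewrite hf he => /andP[_ /negbTE->]; rewrite andbF.
- by rewrite mem_cat he hf -andb_orr orbN andbT.
- by rewrite size_cat.
Qed.

Lemma counted_image (T U : eqType) (f : T -> U) (P : pred T) (Q : pred U) k :
    injective f -> (forall x, Q (f x) = P x) ->
    (forall y, Q y -> exists x, y = f x) ->
  counted P k -> counted Q k.
Proof.
move=> f_inj QfP Qf [e [ue he <-]]; exists (map f e); split=> [|y|].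
- by rewrite map_inj_uniq.
- apply/mapP/idP => [[x + ->]|Qy]; first by rewrite he QfP.
  by have [x xy] := Qf y Qy; exists x; rewrite // he -QfP -xy.
- exact: size_map.
Qed.

Lemma counted_fibers (T : eqType) (w : T -> nat) (P : pred T) (k : nat -> nat) n :
    (forall i, i < n -> counted (fun x => P x && (w x == i)) (k i)) ->
    (forall x, P x -> w x < n) ->
  counted P (\sum_(i < n) k i).
Proof.
elim: n P => [|n IHn] P ck ltw.
  rewrite big_ord0; apply: counted0 => x; apply/negP => /ltw; by [].
rewrite big_ord_recr /= addnC; apply: (counted_split (q := fun x => w x == n)).
  exact: ck.
apply: IHn => [i lt_in|x /andP[/ltw]]; last by lia.
apply: eq_counted (ck i (ltnW lt_in)) => x /=.
by case: (w x =P i) => [->|]; rewrite ?andbF ?andbT // (ltn_eqF lt_in) andbT.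
Qed.

Lemma counted_cons (T : eqType) (P : pred T) (Q : pred (seq T)) k l :
    counted P k -> counted Q l ->
  counted (fun s => if s is x :: t then P x && Q t else false) (k * l).
Proof.
move=> [e [ue he <-]] [f [uf hf <-]].
exists [seq x :: t | x <- e, t <- f]; split=> [|s|].
- by apply: allpairs_uniq => // -[x s] [y t] _ _ [-> ->].
- apply/allpairsP/idP => [[[x t] [/= + + ->]]|].
    by rewrite he hf => -> ->.
  case: s => // x t; move=> /andP[Px Qt].
  by exists (x, t); rewrite he hf.
- exact: size_allpairs.
Qed.

(** * Overpartitions into odd parts of bounded size *)

Definition odd_ovp (b n : nat) (s : overlist) : bool :=
  [&& is_overpartition s, odd_parts s, all (fun x => x.1 <= b) s & weight s == n].

(** These are the tails left after deleting a leading part [b.+1]: further copies of that part may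
    remain, but none of them overlined. *)
Definition plain_odd_ovp (b n : nat) (s : overlist) : bool :=
  odd_ovp b.+1 n s && all (fun x => (x.1 == b.+1) ==> ~~ x.2) s.

(** The right-hand side does not depend on [f], since the first occurrence of a part may be
    overlined or not. This is the source of the doubling in [ovp_number]. *)
Lemma odd_ovp_cons b n f s :
  odd_ovp b.+1 n ((b.+1, f) :: s) =
  [&& odd b.+1, b < n & plain_odd_ovp b (n - b.+1) s].
Proof.
rewrite /plain_odd_ovp /odd_ovp /is_overpartition /odd_parts /weight.
rewrite [sorted _ _]/= path_sortedE; last by move=> x y z /=; lia.
rewrite /= all_map leqnn !andTb.
rewrite (eq_all (a1 := preim _ _) (a2 := fun x => x.1 <= b.+1)) //.
rewrite (eq_all (a1 := fun y => (b.+1 == y.1) ==> ~~ y.2)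
                (a2 := fun x => (x.1 == b.+1) ==> ~~ x.2)); last first.
  by move=> x; rewrite eq_sym.
have -> : (b.+1 + sumn (unzip1 s) == n) =
          (b < n) && (sumn (unzip1 s) == n - b.+1) by lia.
apply/idP/idP.
  by case/and4P=> /and4P[/andP[-> ->] -> -> ->] /andP[-> ->] _ /andP[-> ->].
by case/and4P=> -> -> /and4P[/and3P[-> -> ->] -> -> ->] ->.
Qed.

Definition has_head (c : nat) (s : overlist) : bool :=
  if s is x :: _ then x.1 == c else false.

(** Parts are nonincreasing, so if [b.+1] is not the head it does not occur at all. *)
Lemma odd_ovp_headN b n s :
  odd_ovp b.+1 n s && ~~ has_head b.+1 s = odd_ovp b n s.
Proof.
rewrite /odd_ovp; case: (boolP (is_overpartition s)) => //= ovs.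
case: (odd_parts s); case: (weight s == n); rewrite ?andbF ?andbT //=.
case: s ovs => // x s /and3P[]/= + _ _.
rewrite path_sortedE => [|? ? ? /=]; last by lia.
rewrite all_map => /andP[/allP le_sx _].
apply/idP/idP => [/andP[/andP[le_xb _] ne_xb]|/andP[le_xb les]].
  have lt_xb : x.1 <= b by lia.
  by rewrite lt_xb; apply/allP => y /le_sx /= /leq_trans; apply.
rewrite (leqW le_xb) andTb; apply/andP; split; last by lia.
by apply: sub_all les => y; apply: leqW.
Qed.

Lemma plain_odd_ovp_headN b n s :
  plain_odd_ovp b n s && ~~ has_head b.+1 s = odd_ovp b n s.
Proof.
rewrite -odd_ovp_headN /plain_odd_ovp andbAC; apply/andb_idr.
rewrite odd_ovp_headN => /and4P[_ _ + _]; apply: sub_all => x.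
by move=> /= lex; apply/implyP; lia.
Qed.

(* f is fuel: the value is the intended one only for n <= f. *)
Fixpoint plain_number (p : nat -> nat) (b f n : nat) : nat :=
  p n + (if f is f'.+1 then
           if b < n then plain_number p b f' (n - b.+1) else 0
         else 0).

(* A part of size b, if any, comes first, overlined or not; removing it leaves
   an overpartition with no overlined b. *)
Fixpoint ovp_number (b n : nat) : nat :=
  if b is b'.+1 then
    ovp_number b' n +
    (if odd b && (b' < n) then
       (plain_number (ovp_number b') b' n (n - b)).*2
     else 0)
  else n == 0.

(** A leading [b.+1] is plain here, and deleting it leaves a list of the same kind, of weight
    smaller by [b.+1]; this is the recursion of [plain_number]. *)
Lemma counted_plain_odd_ovp b f n :
    odd b.+1 -> n <= f -> (forall i, counted (odd_ovp b i) (ovp_number b i)) ->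
  counted (plain_odd_ovp b n) (plain_number (ovp_number b) b f n).
Proof.
move=> odd_b + cb; elim: f n => [|f IHf] n le_nf /=; rewrite addnC;
  (apply: (counted_split (q := has_head b.+1));
   last by apply: eq_counted (cb n) => s; rewrite plain_odd_ovp_headN).
- apply: counted0 => -[|[c d] s] /=; rewrite ?andbF //.
  apply/negP => /andP[+ /eqP ecb]; rewrite ecb /plain_odd_ovp odd_ovp_cons.
  by lia.
- case: ltnP => [lt_bn|le_nb]; last first.
    apply: counted0 => -[|[c d] s] /=; rewrite ?andbF //.
    apply/negP => /andP[+ /eqP ecb]; rewrite ecb /plain_odd_ovp odd_ovp_cons.
    by lia.
  apply: (@counted_image _ _ (cons (b.+1, false)) (plain_odd_ovp b (n - b.+1))).
  + by move=> s t [].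
  + move=> s /=; rewrite eqxx andbT {1}/plain_odd_ovp odd_ovp_cons odd_b lt_bn /=.
    rewrite implybT /=.
    by apply/andb_idr => /andP[].
  + case=> [|[c d] s] /=; rewrite ?andbF // => /andP[/andP[_ /= /andP[dP _]] /eqP ecb].
    by move: dP; rewrite ecb eqxx; case: d => // _; exists s.
  + by apply: IHf; lia.
Qed.

Lemma counted_odd_ovp b n : counted (odd_ovp b n) (ovp_number b n).
Proof.
elim: b n => [|b IHb] n /=.
  case: n => [|n] /=.
    apply: (@counted1 _ _ [::]) => -[|[c d] s] //=.
    by rewrite /odd_ovp /is_overpartition /=; case: c => [|c]; rewrite ?ltn0 /= ?andbF.
  apply: counted0 => -[|[c d] s] //=.
  by rewrite /odd_ovp /is_overpartition /=; case: c => [|c]; rewrite ?ltn0 /= ?andbF.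
rewrite addnC; apply: (counted_split (q := has_head b.+1)); last first.
  by apply: eq_counted (IHb n) => s; rewrite odd_ovp_headN.
case: ifP => [/andP[odd_b lt_bn]|oddFb]; last first.
  apply: counted0 => -[|[c d] s] /=; rewrite ?andbF //.
  apply/negP => /andP[+ /eqP ecb]; rewrite ecb odd_ovp_cons.
  by rewrite andbA [X in X && _]oddFb.
have cA : counted (plain_odd_ovp b (n - b.+1))
                  (plain_number (ovp_number b) b n (n - b.+1)).
  by apply: counted_plain_odd_ovp => //; lia.
rewrite -addnn.
apply: (counted_split (q := fun s => if s is x :: _ then x.2 else false)).
  apply: (@counted_image _ _ (cons (b.+1, true)) _ _ _ _ _ _ cA).
  - by move=> s t [].
  - by move=> s /=; rewrite eqxx !andbT odd_ovp_cons /= odd_b lt_bn.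
  - case=> [|[c d] s] /=; rewrite ?andbF // => /andP[/andP[_ /eqP->]].
    by case: d => // _; exists s.
apply: (@counted_image _ _ (cons (b.+1, false)) _ _ _ _ _ _ cA).
- by move=> s t [].
- by move=> s /=; rewrite eqxx !andbT odd_ovp_cons /= odd_b lt_bn.
- case=> [|[c d] s] /=; rewrite ?andbF // => /andP[/andP[_ /eqP->]].
  by case: d => // _; exists s.
Qed.

(** * Tuples and powers of the generating function *)

Fixpoint convolution_power (a : nat -> nat) (m n : nat) : nat :=
  if m is m'.+1 then
    \sum_(i < n.+1) a i * convolution_power a m' (n - i)
  else n == 0.

Lemma convolution_powerS a m n :
  convolution_power a m.+1 n =
  \sum_(i < n.+1) a i * convolution_power a m (n - i).
Proof. by []. Qed.

Lemma leq_part_weight (s : overlist) x : x \in s -> x.1 <= weight s.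
Proof.
elim: s => //= y s IHs; rewrite inE /weight /=.
by case/predU1P=> [->|/IHs]; rewrite /weight; lia.
Qed.

(** Sorting tuples by the weight of their first component gives the convolution. Since [n <= b], the
    bound on part sizes excludes nothing. *)
Lemma counted_odd_ovp_tuple b m n :
    n <= b ->
  counted (fun ts => (size ts == m) && is_odd_overpartition_tuple n ts)
          (convolution_power (ovp_number b) m n).
Proof.
elim: m n => [|m IHm] n le_nb.
  case: n le_nb => [|n] _.
    apply: (@counted1 _ _ [::]) => -[|s ts] //=.
    by rewrite /is_odd_overpartition_tuple /= big_nil.
  apply: counted0 => -[|s ts] //=.
  by rewrite /is_odd_overpartition_tuple /= big_nil.
pose w (ts : seq overlist) := if ts is s :: _ then weight s else 0.
apply: (@counted_fibers _ w _
  (fun i => ovp_number b i * convolution_power (ovp_number b) m (n - i))).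
  move=> i lt_in.
  apply: eq_counted (counted_cons (counted_odd_ovp b i) (IHm (n - i) _)).
    case=> [|s ts] //=.
    rewrite /odd_ovp /is_odd_overpartition_tuple /= big_cons.
    rewrite (eqSS (size ts)).
    have [ws|_] := eqVneq (weight s) i; rewrite ?andbF ?andFb //= !andbT.
    have -> : all (fun x => x.1 <= b) s.
      apply/allP => x /leq_part_weight /leq_trans; apply.
      by rewrite ws (leq_trans _ le_nb).
    rewrite ws; set W := \sum_(_ <- _) _.
    have -> : (i + W == n) = (W == n - i) by lia.
    rewrite andbT.
    by case: (size ts == m); case: (is_overpartition s); case: (odd_parts s);
      rewrite ?andbF.
  by lia.
case=> [|s ts] // /and4P[_ _ _]; rewrite big_cons /=; lia.
Qed.

Lemma OPT_convolution_power b m n :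
  n <= b -> OPT m n = convolution_power (ovp_number b) m n.
Proof.
move=> le_nb; have [e [ue he <-]] := counted_odd_ovp_tuple m le_nb.
have eP ts : (ts \in e) = (size ts == m) && is_odd_overpartition_tuple n ts.
  by rewrite he.
(* All members of [e] have size [m], so [insub] retypes them as tuples without losing any. *)
rewrite (@OPT_count m n (pmap insub e)).
- rewrite size_pmap_sub; apply/eqP; rewrite -all_count; apply/allP => ts.
  by rewrite eP => /andP[].
- exact: pmap_sub_uniq.
- by move=> t; rewrite mem_pmap_sub eP size_tuple eqxx.
Qed.

(** * Residues modulo 2 and 4 *)

(** Unfolded, [plain_number] is the sum of [p (n - j * b.+1)] over the [j] with [j * b.+1 <= n]; the
    only possible odd term is [p 0], which occurs exactly when [b.+1] divides [n]. *)
Lemma odd_plain_number (p : nat -> nat) b f n :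
    (forall i, odd (p i) = (i == 0)) -> n <= f ->
  odd (plain_number p b f n) = (b.+1 %| n).
Proof.
move=> odd_p; elim: f n => [|f IHf] n le_nf /=; rewrite oddD odd_p.
  by case: n le_nf => //; rewrite dvdn0.
case: ltnP => [lt_bn|le_nb].
  by rewrite IHf; last lia; rewrite dvdn_subl // gtn_eqF //; lia.
case: n le_nb {le_nf} => [|n] le_nb; first by rewrite dvdn0.
by rewrite gtnNdvd.
Qed.

Lemma odd_ovp_number b n : odd (ovp_number b n) = (n == 0).
Proof.
elim: b n => [|b IHb] n /=; first by rewrite oddb.
by rewrite oddD IHb; case: ifP; rewrite ?odd_double addbF.
Qed.

(** Each odd [d <= b] contributes twice a number whose parity is that of [d %| n], and doubling
    turns parity into a residue modulo 4. *)
Lemma ovp_number_mod4 b n :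
    0 < n ->
  ovp_number b n = 2 * \sum_(1 <= d < b.+1 | odd d) (d %| n) %[mod 4].
Proof.
move=> n_gt0; elim: b => [|b IHb].
  by rewrite big_geq //=; case: n n_gt0.
rewrite [ovp_number _ _]/= big_mkcond big_nat_recr //= -big_mkcond /=.
have := odd_plain_number b (odd_ovp_number b) (leq_subr b.+1 n).
case: (~~ odd b) => /=; last by rewrite !addn0.
case: ltnP => [lt_bn|le_nb _]; last by rewrite gtnNdvd // !addn0.
rewrite dvdn_subl // => <-; set x := plain_number _ _ _ _.
move: IHb; set y := ovp_number _ _; set z := \sum_(_ <= _ < _ | _) _.
by lia.
Qed.

(** An odd [d] divides [2 * n] exactly when it divides [n], and both sides run over the same
    [d <= b]. *)
Lemma ovp_number_double b n : ovp_number b (2 * n) = ovp_number b n %[mod 4].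
Proof.
case: n => // n; rewrite !ovp_number_mod4 //.
congr (_ * _ %% _); apply: eq_bigr => d odd_d.
by rewrite Gauss_dvdr // coprimen2.
Qed.

Lemma ovp_number0 b : ovp_number b 0 = 1.
Proof. by elim: b => //= b ->; rewrite andbF. Qed.

Lemma convolution_power0 (a : nat -> nat) m :
  a 0 = 1 -> convolution_power a m 0 = 1.
Proof. by move=> a0; elim: m => //= m IHm; rewrite big_ord1 a0 IHm. Qed.

Lemma convolution_power_mod4 (a : nat -> nat) m n :
    a 0 = 1 -> (forall i, odd (a i) = (i == 0)) -> 0 < n ->
  convolution_power a m n = m * a n %[mod 4].
Proof.
move=> a0 odd_a; case: n => // n _; elim: m n => [|m IHm] n //.
rewrite convolution_powerS big_ord_recl big_ord_recr /= a0 subn0 mul1n.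
rewrite subnn convolution_power0 // muln1 /bump /= add1n.
set S := \sum_(i < n) _.
(* In a middle term both factors have positive index: the first is even by hypothesis, the second by
   induction, being [m] times an even number modulo 4. *)
have S4 : 4 %| S.
  apply: dvdn_sum => i _; apply: (@dvdn_mul 2 2); first by rewrite dvdn2 odd_a.
  have -> : n.+1 - (1 + i) = (n - i.+1).+1 by case: i => i /=; lia.
  have := IHm (n - i.+1); have := odd_a (n - i.+1).+1 => /=.
  move: (a _) (convolution_power _ _ _) => x y odd_x.
  have -> : x = x./2 * 2 by lia.
  by rewrite mulnA; move: (m * _) => z; lia.
by have := IHm n; move: S4; rewrite mulSn; move: (m * _) S => x y; lia.
Qed.

(* Coefficients of (1 + 2 q + 2 q ^ 2 + 4 q ^ 3 + 6 q ^ 4 + ...) ^ m. *)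
Lemma OPT_small m :
  [/\ OPT m 1 = 2 * m, OPT m 2 = 2 * m ^ 2
    & 3 * OPT m 4 = 2 * m ^ 4 + 16 * m ^ 2].
Proof.
rewrite !(@OPT_convolution_power 4) //.
have av : [/\ ovp_number 4 1 = 2, ovp_number 4 2 = 2, ovp_number 4 3 = 4
             & ovp_number 4 4 = 6] by [].
(* Coefficient 3 is added because the induction step for coefficient 4 uses it; the factors 3 clear
   denominators. *)
suff: [/\ convolution_power (ovp_number 4) m 1 = 2 * m,
          convolution_power (ovp_number 4) m 2 = 2 * m ^ 2,
          3 * convolution_power (ovp_number 4) m 3 = 4 * m ^ 3 + 8 * m
        & 3 * convolution_power (ovp_number 4) m 4 = 2 * m ^ 4 + 16 * m ^ 2].
  by case.
have a0 := ovp_number0 4.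
move: (ovp_number 4) a0 av => a a0 [a1 a2 a3 a4].
elim: m => [//|m [c1 c2 c3 c4]].
rewrite !convolution_powerS !big_ord_recr !big_ord0 /= !subn0 !subnn.
rewrite a0 a1 a2 a3 a4.
rewrite -[4 - 1]/3 -[4 - 2]/2 -[4 - 3]/1 -[3 - 1]/2 -[3 - 2]/1 -[2 - 1]/1.
rewrite convolution_power0 // c1 c2.
by move: c3 c4; rewrite !expnS !expn0; split; lia.
Qed.

Theorem theorem1p3 (m k : nat) (hm : m = 2 * k + 1) :
  [/\ ((OPT m 2)%:Z - (OPT m 1)%:Z = - (4 * k)%:Z %[mod 16])%Z,
      ((OPT m 4)%:Z - (OPT m 2)%:Z = 4 %[mod 16])%Z
    & forall n : nat,
        OPT m (2 * n) = OPT m n %[mod 4] /\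
        OPT m (4 * n) = OPT m (2 * n) %[mod 4]].
Proof.
have [o1 o2 o4] := OPT_small m.
(* As [m ^ 2 = 4 * (k * k.+1) + 1], the evenness of [k * k.+1] gives [m ^ 2 = 1] modulo 8. *)
have [t kk] : exists t, k * k.+1 = 2 * t.
  by exists (k * k.+1)./2; rewrite mul2n even_halfK //= oddM /= andbN.
have m2 : m ^ 2 = 8 * t + 1 by rewrite hm; nia.
have m4 : m ^ 4 = 64 * t ^ 2 + 16 * t + 1.
  by rewrite (expnM m 2 2) m2; nia.
have double n : OPT m (2 * n) = OPT m n %[mod 4].
  (* The bound [2 * n.+1] serves both weights, so both sides are convolution powers of one
     sequence. *)
  case: n => // n; rewrite !(@OPT_convolution_power (2 * n.+1)) //; last by lia.
  have a0 := ovp_number0 (2 * n.+1); have odd_a := odd_ovp_number (2 * n.+1).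
  by rewrite !convolution_power_mod4 // -modnMmr ovp_number_double modnMmr.
split.
- by rewrite o1 o2 m2; lia.
(* Modulo 16, [3 * OPT m 4] is 2; as 3 is invertible, [OPT m 4] is 6, while [OPT m 2] is 2. *)
- by move: o4; rewrite o2 m2 m4; lia.
- by move=> n; split; rewrite ?(mulnA 2 2 n); [|rewrite -[4]/(2 * 2) -mulnA];
    apply: double.
Qed.
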